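(* Let $p$ be a prime. Then the $p$-local representation zeta function of the group $M_{p+1}$ is \[ \zeta^{irr}_{M_{p+1},p}(s) =\frac{(1-p^{-s})^2}{(1-p^{(p-1)-s})(1-p^{1-s})}. \]
   Context: For $n\ge 2$, $M_n$ denotes the finitely generated torsion-free nilpotent group with presentation $M_n=\langle a_1,\ldots,a_n,b \mid [a_i,b]=a_{i+1}\ (1\le i\le n-1)\rangle$, where all commutators of generators not given by (or following from) these relations are trivial (so $[a_i,a_j]=1$ for all $i,j$ and $[a_n,b]=1$). Two complex representations $\rho_1,\rho_2$ of a group $G$ are twist-equivalent if $\rho_1\cong\chi\otimes\rho_2$ for some one-dimensional representation $\chi$ of $G$. For a finitely generated torsion-free nilpotent group $G$, $r_m(G)$ denotes the (finite) number of irreducible complex representations of $G$ of degree $m$ up to isomorphism and twist-equivalence. For a prime $p$, the $p$-local representation zeta function is $\zeta^{irr}_{G,p}(s)=\sum_{N=0}^{\infty} r_{p^N}(G)\,p^{-Ns}$. *)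

(* Defs.v *)
From HB Require Import structures.
From mathcomp Require Import all_boot all_order all_algebra.
Set Implicit Arguments. Unset Strict Implicit. Unset Printing Implicit Defensive.
Import Order.TTheory GRing.Theory Num.Theory.
Local Open Scope ring_scope.

(* A representation of degree m of the finitely presented group
   M_n = < a_1..a_n, b | [a_i,a_j]=1, [a_i,b]=a_{i+1} (i<n), [a_n,b]=1 >
   over the field C is given (universal property of presentations) by the
   images of the generators: a family of m x m matrices (a 0, ..., a (n-1))
   standing for a_1..a_n, and a matrix b, which are invertible and satisfy the
   defining relations.  Commutator convention [x,y] = x^-1 y^-1 x y. *)

Definition repT (C : fieldType) (m : nat) : Type :=
  ((nat -> 'M[C]_m) * 'M[C]_m)%type.

Definition mxcomm (C : fieldType) (m : nat) (X Y : 'M[C]_m) : 'M[C]_m :=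
  invmx X *m invmx Y *m X *m Y.

Definition is_rep (C : fieldType) (n m : nat) (r : repT C m) : Prop :=
  [/\ (forall i, (i < n)%N -> r.1 i \in unitmx),
      r.2 \in unitmx,
      (forall i j, (i < n)%N -> (j < n)%N -> r.1 i *m r.1 j = r.1 j *m r.1 i),
      (forall i, (i.+1 < n)%N -> mxcomm (r.1 i) r.2 = r.1 i.+1)
    & mxcomm (r.1 n.-1) r.2 = 1%:M].

Definition is_irr (C : fieldType) (n m : nat) (r : repT C m) : Prop :=
  [/\ is_rep n r, (0 < m)%N &
      forall U : 'M[C]_m,
        (forall i, (i < n)%N -> stablemx U (r.1 i)) -> stablemx U r.2 ->
        \rank U = 0%N \/ \rank U = m].

Definition rep_iso (C : fieldType) (n m : nat) (r s : repT C m) : Prop :=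
  exists2 P : 'M[C]_m, P \in unitmx &
    (forall i, (i < n)%N -> P *m r.1 i = s.1 i *m P) /\ P *m r.2 = s.2 *m P.

Definition twist (C : fieldType) (m : nat) (chi : repT C 1) (r : repT C m)
  : repT C m :=
  (fun i => chi.1 i 0 0 *: r.1 i, chi.2 0 0 *: r.2).

Definition twist_equiv (C : fieldType) (n m : nat) (r s : repT C m) : Prop :=
  exists chi : repT C 1, is_rep n chi /\ rep_iso n (twist chi r) s.

Definition rcount (C : fieldType) (n m k : nat) : Prop :=
  exists f : 'I_k -> repT C m,
    [/\ forall i, is_irr n (f i),
        forall i j, twist_equiv n (f i) (f j) -> i = j &
        forall r : repT C m, is_irr n r -> exists i, twist_equiv n r (f i)].

(* Main.v *)
Require Import Defs.
From HB Require Import structures.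
From mathcomp Require Import all_boot all_order all_algebra.
From mathcomp Require Import perm spectral separable zify ring.
Set Implicit Arguments. Unset Strict Implicit. Unset Printing Implicit Defensive.
Import Order.TTheory GRing.Theory Num.Theory.

(* In an irreducible representation the commuting a_i have a common
   eigenvector; its weight s = (s_1, .., s_n) is moved by b^-1 to the weight
   tw s = (s_1 s_2, .., s_{n-1} s_n, s_n).  Irreducible representations of
   degree m therefore correspond, up to a scalar in b, to tw-orbits of size m,
   and twisting by characters kills that scalar and normalises s_1 = 1.  So
   r_m counts the tw-orbits of y = (s_2, .., s_n) such that 1 :: y has exact
   period m.  For d | m, the y with tw^m (1 :: y) = 1 :: y and tw^d y = y form a
   triangular system with m d^(n-2) solutions, so by Burnside's lemma the orbits
   of the y with tw^m (1 :: y) = 1 :: y number sum_{j < m} gcd(j, m)^(n-2).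
   Taking differences over m = p^N gives r_{p^N}, and splitting the sum according
   to p | j gives a linear recurrence equivalent to the closed form of zeta. *)

(** * Iterates of a map, Burnside counting for a cyclic action, and gcd sums *)

Lemma iter_mul_id {T : Type} (f : T -> T) (d e : nat) (x : T) :
  iter d f x = x -> iter (e * d)%N f x = x.
Proof. by move=> fx; elim: e => [|e IHe] //; rewrite mulSn iterD IHe. Qed.

Lemma iter_dvd_id {T : Type} (f : T -> T) (d m : nat) (x : T) :
  (d %| m)%N -> iter d f x = x -> iter m f x = x.
Proof. by move=> /dvdnP[e ->]; apply: iter_mul_id. Qed.

(** By Bezout some [a * k + gcdn m k] is a multiple of [m]; both this number and [a * k] fix [x]. *)
Lemma iter_gcdn_id {T : eqType} (f : T -> T) (m k : nat) (x : T) :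
  (0 < m)%N -> iter m f x = x ->
  (iter k f x == x) = (iter (gcdn k m) f x == x).
Proof.
move=> m0 fm; apply/eqP/eqP => [fk|]; last exact: iter_dvd_id (dvdn_gcdl _ _).
have [a _ /dvdnP[b Hb]] := Bezoutl k m0.
have : iter (a * k + gcdn m k)%N f x = x.
  by rewrite addnC Hb; apply: iter_mul_id.
by rewrite addnC iterD iter_mul_id // gcdnC.
Qed.

Lemma sum_mul_nat (e d : nat) (F : nat -> nat) :
  (\sum_(k < e * d) F k = \sum_(j < e) \sum_(i < d) F (j * d + i))%N.
Proof.
elim: e => [|e IHe]; first by rewrite !big_ord0.
by rewrite mulSnr big_split_ord /= big_ord_recr /= IHe.
Qed.

Lemma sum_periodic (e d : nat) (F : nat -> nat) :
  (forall k, F (d + k) = F k)%N ->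
  (\sum_(k < e * d) F k = e * \sum_(k < d) F k)%N.
Proof.
move=> Fd; rewrite sum_mul_nat -[in RHS](card_ord e) -sum_nat_const.
apply: eq_bigr => j _; apply: eq_bigr => i _.
by elim: (nat_of_ord j) => [|{}j IHj] //; rewrite mulSn -addnA Fd.
Qed.

(** Burnside's lemma for Z/m acting through [f] on the invariant set [E]: each [x] is fixed by
    [m %/ order f x] of the exponents below [m], so an orbit contributes [m] in all. The points with
    [froot f x == x] represent the orbits. *)
Lemma orbit_count (T : finType) (f : T -> T) (m : nat) (E : {set T}) :
  (0 < m)%N -> (forall x, iter m f x = x) ->
  (forall x, (f x \in E) = (x \in E)) ->
  (\sum_(k < m) #|[set x in E | iter k f x == x]| =
    m * #|[set x in E | froot f x == x]|)%N.
Proof.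
move=> m0 fm fE.
have fI : injective f.
  move=> x y fxy; rewrite -(fm x) -(fm y) -(prednK m0) !iterSr.
  by rewrite fxy.
have ordP x k : (iter k f x == x) = (order f x %| k).
  apply/eqP/idP => [fk|]; last by move=> dk; apply: (iter_dvd_id dk); apply: iter_order.
  rewrite /dvdn; set r := (k %% order f x)%N.
  have fr : iter r f x = x.
    rewrite -[RHS]fk (divn_eq k (order f x)) addnC iterD iter_mul_id //.
    exact: iter_order.
  (* A nonzero remainder would give [x] the index [r] in its own orbit, where its index is 0. *)
  apply/eqP; case: (posnP r) => // r0.
  have lr : (r < order f x)%N by rewrite ltn_mod order_gt0.
  have := findex_iter lr; rewrite fr => r1.
  by have := findex0 f x; rewrite r1 => rr; rewrite rr in r0.
have fxE x k : (iter k f x \in E) = (x \in E) by elim: k => //= k <-.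
have one (x : T) : (\sum_(k < m) (iter k f x == x) = m %/ order f x)%N.
  have om : order f x %| m by rewrite -ordP fm.
  under eq_bigr => k _ do rewrite ordP.
  have := @sum_periodic (m %/ order f x) (order f x) (fun k => order f x %| k)%N.
  rewrite divnK // => ->; last by move=> k; rewrite dvdn_addr.
  rewrite -(prednK (order_gt0 f x)) big_ord_recl dvdn0 big1 ?muln1 //= => i _.
  by rewrite gtnNdvd //= /bump ltnS.
have fcE x y : (x \in fconnect f y) = (froot f y == froot f x).
  exact: esym (root_connect (fconnect_sym fI) y x).
transitivity (\sum_(x in E) (m %/ order f x))%N.
  rewrite (eq_bigr (fun k : 'I_m => \sum_(x in E) (iter k f x == x))%N) => [|k _].
    by rewrite exchange_big /=; apply: eq_bigr => x _; rewrite one.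
  by rewrite -sum1dep_card big_mkcondr; apply: eq_bigr => x _; case: ifP.
rewrite (partition_big (froot f) (mem [set x in E | froot f x == x])) /=; last first.
  move=> x xE; rewrite inE -(iter_findex (connect_root _ x)) fxE xE.
  rewrite (iter_findex (connect_root _ x)) /=.
  by apply/eqP/root_root/fconnect_sym.
rewrite mulnC -sum_nat_const; apply: eq_bigr => z; rewrite inE => /andP[zE /eqP rz].
transitivity (\sum_(x in fconnect f z) (m %/ order f z))%N.
  apply: eq_big => [x|x /andP[xE /eqP xz]].
    rewrite fcE rz eq_sym.
    case: eqP => [xz|]; rewrite ?andbF ?andbT //.
    by rewrite -(fxE x (findex f x z)) iter_findex // xz connect_root.
  congr (m %/ _)%N; apply: eq_card => y.
  by rewrite !fcE rz xz.
rewrite sum_nat_const -/(order f z) mulnC divnK //.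
by rewrite -ordP fm.
Qed.

(** Write k = j p + i with i < p: the terms with i = 0 give p^e gcd(j, p^N)^e, and the p - 1 others,
    being prime to p, give 1 each. Adding p^N on the left avoids a subtraction. *)
Lemma gcd_sum_prime_power (p e N : nat) : prime p ->
  (\sum_(k < p ^ N.+1) gcdn k (p ^ N.+1) ^ e + p ^ N =
   p ^ e * (\sum_(k < p ^ N) gcdn k (p ^ N) ^ e) + p ^ N.+1)%N.
Proof.
(* From here the prime is [p.+1], and [p] is the number of nonzero residues. *)
case: p => // p pp.
have := sum_mul_nat (p.+1 ^ N) p.+1 (fun k => gcdn k (p.+1 ^ N.+1) ^ e)%N.
rewrite -expnSr => ->.
have inner (j : nat) : (\sum_(i < p.+1) gcdn (j * p.+1 + i) (p.+1 ^ N.+1) ^ e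
    = p.+1 ^ e * gcdn j (p.+1 ^ N) ^ e + p)%N.
  rewrite big_ord_recl /= addn0; congr (_ + _)%N.
    by rewrite expnSr -muln_gcdl expnMn mulnC.
  rewrite -[RHS]muln1 -[in RHS](card_ord p) -sum_nat_const; apply: eq_bigr => i _.
  suff /eqP -> : coprime (j * p.+1 + bump 0 i) (p.+1 ^ N.+1) by rewrite exp1n.
  rewrite coprimeXr // coprime_sym prime_coprime // dvdn_addr ?dvdn_mull //.
  by rewrite gtnNdvd // /bump /= add1n ltnS.
under eq_bigr => j _ do rewrite inner.
rewrite big_split /= -big_distrr /= sum_nat_const card_ord -addnA; congr (_ + _)%N.
by rewrite expnSr -mulnSr.
Qed.

(** * The map [tw] on weights *)

Local Open Scope ring_scope.

(* If v is a row vector with v a_i = s_i v for all i, then v b^-1 is one for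
   the weight [tw s]; entries of a weight beyond its length count as 1. *)
Fixpoint tw {F : fieldType} (s : seq F) : seq F :=
  if s is a :: s' then a * head 1 s' :: tw s' else [::].

(** The factor that [k] steps of [tw] put on an entry standing in front of [s]; it depends on [s]
    alone, which makes the periodicity equations triangular. *)
Definition tw_factor {F : fieldType} (k : nat) (s : seq F) : F :=
  \prod_(l < k) head 1 (iter l tw s).

Definition nonzero {F : fieldType} (s : seq F) : bool := all (predC1 0) s.

(* The tail y = (s_2, .., s_n) of a weight normalised by s_1 = 1. *)
Definition periodic {F : fieldType} (k : nat) (s : seq F) : bool :=
  iter k tw (1 :: s) == 1 :: s.

Section Tw.
Context {F : fieldType}.
Implicit Types (s y : seq F) (a x : F) (k d m : nat).

Lemma size_tw s : size (tw s) = size s.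
Proof. by elim: s => //= a s ->. Qed.

Lemma size_iter_tw k s : size (iter k tw s) = size s.
Proof. by elim: k => //= k <-; rewrite size_tw. Qed.

Lemma nth_tw s i : nth 1 (tw s) i = nth 1 s i * nth 1 s i.+1.
Proof.
by elim: s i => [|a s IHs] [|i] /=; rewrite ?mulr1 ?nth0.
Qed.

Lemma head_nonzero s : nonzero s -> head 1 s != 0.
Proof. by case: s => [|a s] /=; rewrite ?oner_neq0 // => /andP[]. Qed.

Lemma nonzero_tw s : nonzero s -> nonzero (tw s).
Proof.
elim: s => //= a s IHs /andP[a0 sN]; rewrite /= mulf_neq0 ?head_nonzero //.
exact: IHs.
Qed.

Lemma nonzero_iter_tw k s : nonzero s -> nonzero (iter k tw s).
Proof. by move=> sN; elim: k => //= k; apply: nonzero_tw. Qed.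

Lemma nth_nonzero s i : nonzero s -> nth 1 s i != 0.
Proof.
move=> /allP sN; case: (ltnP i (size s)) => Hi; first exact/sN/mem_nth.
by rewrite nth_default ?oner_neq0.
Qed.

(** The last entry is unchanged; going backwards, each entry is recovered on dividing by the next
    one. *)
Lemma tw_inj s t : nonzero s -> nonzero t -> tw s = tw t -> s = t.
Proof.
elim: s t => [|a s IHs] [|b t] //= /andP[a0 sN] /andP[b0 tN] [eqab eqst].
have st := IHs _ sN tN eqst; rewrite st in eqab *.
by rewrite (mulIf _ eqab) ?head_nonzero.
Qed.

Lemma iter_tw_inj k s t : nonzero s -> nonzero t -> iter k tw s = iter k tw t -> s = t.
Proof.
move=> sN tN; elim: k => //= k IHk eqst; apply: IHk.
by apply: tw_inj eqst; apply: nonzero_iter_tw.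
Qed.

Lemma iter_tw_cons k a s : iter k tw (a :: s) = a * tw_factor k s :: iter k tw s.
Proof.
rewrite /tw_factor; elim: k => [|k IHk]; first by rewrite big_ord0 mulr1.
by rewrite big_ord_recr iterS IHk /= mulrA.
Qed.

Lemma tw_factor_neq0 k s : nonzero s -> tw_factor k s != 0.
Proof. by move=> sN; apply/prodf_neq0 => l _; apply/head_nonzero/nonzero_iter_tw. Qed.

(** The first entry is only multiplied by a factor independent of it, so any nonzero value may be
    replaced by 1. *)
Lemma iter_tw_cons_eq k a s : a != 0 -> (iter k tw (a :: s) == a :: s) = periodic k s.
Proof.
move=> a0; rewrite /periodic !iter_tw_cons !eqseq_cons mul1r.
by rewrite -[X in _ == X](mulr1 a) (inj_eq (mulfI a0)).
Qed.

Lemma tw_factor_cons k x s : tw_factor k (x :: s) = x ^+ k * \prod_(l < k) tw_factor l s.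
Proof.
rewrite {1}/tw_factor; under eq_bigr => l _ do rewrite iter_tw_cons /=.
by rewrite big_split /= prodr_const card_ord.
Qed.

(** One more entry [x] adds a single equation, on x^k, whose constant depends on [s] only. *)
Lemma periodic_cons k x s : x != 0 ->
  periodic k (x :: s) = (x ^+ k * \prod_(l < k) tw_factor l s == 1) && periodic k s.
Proof.
move=> x0; rewrite {1}/periodic iter_tw_cons eqseq_cons mul1r tw_factor_cons.
by rewrite iter_tw_cons_eq.
Qed.

Lemma periodic_dvd d m s : (d %| m)%N -> periodic d s -> periodic m s.
Proof. by move=> dm /eqP ds; apply/eqP; apply: iter_dvd_id ds. Qed.

Lemma periodic_iter_tw d s : periodic d s -> iter d tw s = s.
Proof. by rewrite /periodic iter_tw_cons eqseq_cons => /andP[_ /eqP]. Qed.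

Lemma iter_tw_sub s i j : nonzero s -> (i < j)%N ->
  iter i tw s = iter j tw s -> iter (j - i) tw s = s.
Proof.
move=> sN ltij eqij; apply/esym/(@iter_tw_inj i) => //; first exact: nonzero_iter_tw.
by rewrite -iterD subnKC // ltnW.
Qed.

Lemma periodic_tw j y :
  nonzero y -> periodic j (tw y) = periodic j y.
Proof.
move=> yN; have yN1 : nonzero (1 :: y) by rewrite /= oner_neq0.
rewrite -(iter_tw_cons_eq _ _ (head_nonzero yN)).
have -> : head 1 y :: tw y = tw (1 :: y) by rewrite /= mul1r.
rewrite -iterSr /periodic; apply/eqP/eqP => [|E]; last by rewrite iterS E.
by rewrite iterS; apply: tw_inj => //; apply: nonzero_iter_tw.
Qed.

End Tw.

(** * Listing the periodic weights *)

(** In characteristic zero X^m - c is prime to its derivative m X^(m-1), so its roots are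
    distinct. *)
Lemma roots_list {C : numClosedFieldType} (m : nat) (c : C) :
  (0 < m)%N -> c != 0 ->
  {rs : seq C | [/\ uniq rs, size rs = m & forall x, (x \in rs) = (x ^+ m == c)]}.
Proof.
move=> m0 c0; have [rs Hrs] := closed_field_poly_normal ('X^m - c%:P).
rewrite lead_coefXnsubC // scale1r in Hrs.
exists rs; have mem x : (x \in rs) = (x ^+ m == c).
  rewrite -root_prod_XsubC -Hrs rootE !hornerE.
  by rewrite subr_eq0.
split=> //; last first.
  by apply: succn_inj; rewrite -(size_prod_XsubC rs id) -Hrs size_XnsubC.
rewrite -separable_prod_XsubC -Hrs unlock.
rewrite derivB derivC subr0 derivXn -scaler_nat coprimepZr ?pnatr_eq0 -?lt0n //.
rewrite coprimep_expr // coprimepX /root !hornerE expr0n.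
by rewrite eqn0Ngt m0 /= sub0r oppr_eq0.
Qed.

(** One step of the triangular system: each [s] extends by the [m] roots of x^m = 1 / w(s). *)
Lemma cons_list {C : numClosedFieldType} (m : nat) (L : seq (seq C))
    (w : seq C -> C) :
  (0 < m)%N -> uniq L -> {in L, forall s, w s != 0} ->
  {L' : seq (seq C) | [/\ uniq L', size L' = (m * size L)%N, [::] \notin L' &
    forall x s, (x :: s \in L') = (x ^+ m * w s == 1) && (s \in L)]}.
Proof.
move=> m0; elim: L => [|s L IHL] /=.
  by exists [::]; split=> // [|x s]; rewrite ?muln0 // in_nil andbF.
move=> /andP[sL uL] wN; have [|L' [uL' sL' nL' memL']] := IHL uL.
  by move=> t tL; apply: wN; rewrite inE tL orbT.
have ws : w s != 0 by apply: wN; rewrite mem_head.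
have [rs [urs srs memrs]] := @roots_list C m (w s)^-1 m0 (invr_neq0 ws).
exists ([seq x :: s | x <- rs] ++ L'); split.
- rewrite cat_uniq map_inj_uniq ?urs ?uL' ?andbT /=; last by move=> x y [].
  by apply/hasPn => t tL'; apply/mapP => -[x _ et]; rewrite et memL' (negPf sL) andbF in tL'.
- by rewrite size_cat size_map srs sL' mulnS.
- by rewrite mem_cat negb_or nL' andbT; apply/mapP => -[].
move=> x t; rewrite mem_cat memL' inE; have [->|ts] := eqVneq t s.
  rewrite (negPf sL) andbF orbF andbT mem_map; last by move=> a b [].
  by rewrite memrs -(inj_eq (mulIf ws)) mulVf.
case: mapP => [[y _ [_ est]]|_] //; by rewrite est eqxx in ts.
Qed.

Lemma periodic_list {C : numClosedFieldType} (d k : nat) : (0 < d)%N ->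
  {L : seq (seq C) | [/\ uniq L, size L = (d ^ k)%N &
    forall s, (s \in L) = [&& size s == k, nonzero s & periodic d s]]}.
Proof.
move=> d0; elim: k => [|k [L [uL sL memL]]].
  exists [:: [::]]; split=> // -[|a s]; rewrite inE //=.
  have iter_nil l : iter l tw [::] = [::] :> seq C.
    by apply/size0nil; rewrite size_iter_tw.
  by rewrite /periodic iter_tw_cons iter_nil /tw_factor big1 ?mulr1 ?eqxx // => l _; rewrite iter_nil.
have [|L' [uL' sL' nL' memL']] := @cons_list C d L (fun s => \prod_(l < d) tw_factor l s) d0 uL.
  by move=> s; rewrite memL => /and3P[_ sN _]; apply/prodf_neq0 => l _; apply: tw_factor_neq0.
exists L'; split=> [//||]; first by rewrite sL' sL expnS.
case=> [|x s]; first by rewrite (negPf nL').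
rewrite memL' memL /= eqSS; have [->|x0] := eqVneq x 0.
  by rewrite expr0n eqn0Ngt d0 mul0r eq_sym oner_eq0 andbF.
by rewrite periodic_cons //; case: (_ == 1); case: (size s == k); case: (nonzero s).
Qed.

(** For nonzero x, tw^d fixes x :: s exactly when [periodic d s]; then [periodic m s] follows, and
    only the equation on x^m remains. This leaves d^k choices of s and m of x. *)
Lemma periodic_fix_list {C : numClosedFieldType} (m d k : nat) :
  (0 < m)%N -> (d %| m)%N ->
  {L : seq (seq C) | [/\ uniq L, size L = (m * d ^ k)%N &
    forall s, (s \in L) = [&& size s == k.+1, nonzero s, periodic m s & iter d tw s == s]]}.
Proof.
move=> m0 dm; have d0 : (0 < d)%N by rewrite (dvdn_gt0 m0).
have [L [uL sL memL]] := @periodic_list C d k d0.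
have [|L' [uL' sL' nL' memL']] := @cons_list C m L (fun s => \prod_(l < m) tw_factor l s) m0 uL.
  by move=> s; rewrite memL => /and3P[_ sN _]; apply/prodf_neq0 => l _; apply: tw_factor_neq0.
exists L'; split=> [//||]; first by rewrite sL' sL.
case=> [|x s]; first by rewrite (negPf nL').
rewrite memL' memL [size (_ :: _)]/= eqSS; have [->|x0] := eqVneq x 0.
  by rewrite expr0n eqn0Ngt m0 mul0r eq_sym oner_eq0 /= eqxx andbF.
rewrite periodic_cons // iter_tw_cons_eq // /= x0 /=.
have := @periodic_dvd _ d m s dm.
case: (_ == 1); case: (size s == k); case: (nonzero s); case: (periodic d s) => //=; rewrite ?andbF //.
by move=> ->.
Qed.

(** * Independence of vectors of distinct weights *)

(* The projection is the product over l != k of the A i - (w l)_i, with i chosen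
   so that (w k)_i != (w l)_i; hence it preserves every A-stable subspace. *)
Lemma weight_proj {F : fieldType} (n d m : nat) (A : nat -> 'M[F]_m)
    (V : 'M[F]_(d, m)) (w : 'I_d -> seq F) :
  (forall i k, (i < n)%N -> row k V *m A i = nth 1 (w k) i *: row k V) ->
  (forall k, size (w k) = n) -> injective w ->
  forall k, exists K : 'M[F]_m,
    [/\ row k V *m K = row k V, forall j, j != k -> row j V *m K = 0 &
     forall (q : nat) (U : 'M_(q, m)),
       (forall i, (i < n)%N -> stablemx U (A i)) -> stablemx U K].
Proof.
move=> VA sw wI k.
suff H (r : seq 'I_d) : k \notin r -> exists K : 'M[F]_m,
    [/\ row k V *m K = row k V, forall j, j \in r -> row j V *m K = 0,
     forall j, exists c, row j V *m K = c *: row j V &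
     forall (q : nat) (U : 'M_(q, m)),
       (forall i, (i < n)%N -> stablemx U (A i)) -> stablemx U K].
  have [|K [Kk Kj _ KU]] := H (rem k (enum 'I_d)).
    by rewrite mem_rem_uniq ?enum_uniq // inE eqxx.
  exists K; split=> // j jk; apply: Kj.
  by rewrite mem_rem_uniq ?enum_uniq // inE jk mem_enum.
elim: r => [_|l r IHr].
  exists 1%:M; split=> [||j|q U _]; rewrite ?mulmx1 //.
  by exists 1; rewrite scale1r.
rewrite inE negb_or => /andP[kl /IHr[K [Kk Kr Kc KU]]].
have /existsP[i Hi] : [exists i : 'I_n, nth 1 (w k) i != nth 1 (w l) i].
  apply: contraR kl => /existsPn Hkl; apply/eqP/wI/(@eq_from_nth _ 1); rewrite !sw //.
  by move=> i lti; apply/eqP; have := Hkl (Ordinal lti); rewrite negbK.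
pose c := nth 1 (w k) i - nth 1 (w l) i.
have c0 : c != 0 by rewrite subr_eq0.
have VL j : row j V *m (A i - (nth 1 (w l) i)%:M) = (nth 1 (w j) i - nth 1 (w l) i) *: row j V.
  by rewrite mulmxBr VA // mul_mx_scalar scalerBl.
exists (c^-1 *: ((A i - (nth 1 (w l) i)%:M) *m K)); split.
- by rewrite -scalemxAr mulmxA VL -scalemxAl Kk scalerA mulVf // scale1r.
- move=> j; rewrite inE -scalemxAr mulmxA VL -scalemxAl => /predU1P[->|/Kr ->].
    by rewrite subrr scale0r scaler0.
  by rewrite !scaler0.
- move=> j; have [x Hx] := Kc j.
  exists (c^-1 * ((nth 1 (w j) i - nth 1 (w l) i) * x)).
  by rewrite -scalemxAr mulmxA VL -scalemxAl Hx !scalerA !mulrA.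
move=> q U UA; rewrite -mul_scalar_mx; apply: stablemxM; first exact: stablemxC.
apply: stablemxM (KU _ _ UA).
by apply: stablemxD; rewrite ?stablemxN ?UA ?stablemxC.
Qed.

(** Applied to a vanishing combination, the projection for the k-th weight isolates the k-th
    coefficient. *)
Lemma weight_free {F : fieldType} (n d m : nat) (A : nat -> 'M[F]_m)
    (V : 'M[F]_(d, m)) (w : 'I_d -> seq F) :
  (forall i k, (i < n)%N -> row k V *m A i = nth 1 (w k) i *: row k V) ->
  (forall k, size (w k) = n) -> injective w ->
  (forall k, row k V != 0) -> row_free V.
Proof.
move=> VA sw wI V0; apply: inj_row_free => v vV0; apply/rowP => k; rewrite mxE.
have [K [Kk Kj _]] := weight_proj VA sw wI k.
have: v *m V *m K = 0 by rewrite vV0 mul0mx.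
rewrite (mulmx_sum_row v) mulmx_suml (bigD1 k) //= big1 => [|j jk].
  by rewrite addr0 -scalemxAl Kk => /eqP; rewrite scaler_eq0 (negPf (V0 k)) orbF => /eqP.
by rewrite -scalemxAl Kj // scaler0.
Qed.

(** * The model representation attached to a periodic weight *)

Lemma mxcommP {C : fieldType} {m : nat} (X Y Z : 'M[C]_m) :
  X \in unitmx -> Y \in unitmx ->
  mxcomm X Y = Z <-> X *m Y = Y *m X *m Z.
Proof.
move=> uX uY; split=> [<-|XY].
  by rewrite /mxcomm !mulmxA mulmxK // mulmxV // mul1mx.
by rewrite /mxcomm -(mulmxA _ X Y) XY !mulmxA mulmxKV // mulVmx // mul1mx.
Qed.

(** [ord_pred] is cyclic: descend from [j] to 0, wrap round to the top, and descend again. *)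
Lemma ord_pred_closed {m : nat} (P : pred 'I_m) (j : 'I_m) :
  (forall k, P k -> P (ord_pred k)) -> P j -> forall k, P k.
Proof.
case: m P j => [|m] P j PS Pj; first by case: (j).
have down (l : 'I_m.+1) : P l -> forall t (k : 'I_m.+1), (k + t)%N = l -> P k.
  move=> Pl; elim=> [|t IHt] k; first by rewrite addn0 => /val_inj ->.
  rewrite addnS => kl; rewrite -(ordSK k); apply/PS/IHt => /=.
  by rewrite modn_small // (leq_ltn_trans _ (ltn_ord l)) // -kl ltnS leq_addr.
have P0 : P ord0 by apply: (down _ Pj j).
have Pmax : P ord_max.
  suff -> : ord_max = ord_pred ord0 :> 'I_m.+1 by apply: PS.
  by apply: val_inj; rewrite /= modn_small.
by move=> k; apply: (down _ Pmax (m - k)%N); rewrite subnKC // -ltnS.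
Qed.

(* The basis vector e_k has weight tw^k s, and e_k b = e_(k-1), indices mod m. *)
Definition weight_rep {C : fieldType} (m : nat) (s : seq C) : repT C m :=
  (fun i => diag_mx (\row_(k < m) nth 1 (iter k tw s) i),
   perm_mx (perm (@ord_pred_inj m))).

(** Minimality of the period is put as distinctness of the first [m] iterates, the form that
    independence of weight vectors uses. *)
Definition exact_period {C : fieldType} (m : nat) (s : seq C) : Prop :=
  iter m tw s = s /\ injective (fun k : 'I_m => iter k tw s).

Lemma exact_period_min {C : fieldType} (m : nat) (s : seq C) :
  nonzero s -> iter m tw s = s ->
  (forall j, (0 < j < m)%N -> iter j tw s != s) -> exact_period m s.
Proof.
move=> sN ms smin; split=> // i j /= eqij; apply/val_inj => /=.
wlog ltij : i j eqij / (i < j)%N.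
  by move=> H; case: (ltngtP i j) => // ltij; [| symmetry]; apply: H.
have /eqP[] : iter (j - i) tw s != s; last exact: iter_tw_sub.
by rewrite smin // subn_gt0 ltij (leq_ltn_trans (leq_subr _ _)).
Qed.

Lemma row_ord_pred_mul {C : fieldType} (m q : nat) (k : 'I_m) (X : 'M[C]_(m, q)) :
  row k (perm_mx (perm (@ord_pred_inj m)) *m X) = row (ord_pred k) X.
Proof. by rewrite -row_permE; apply/rowP => j; rewrite !mxE permE. Qed.

Lemma iter_ord_pred {T : Type} (f : T -> T) (x : T) (m : nat) (k : 'I_m) :
  iter m f x = x -> iter k f x = f (iter (ord_pred k) f x).
Proof.
move=> fm; rewrite -iterS /=; case: k => [[|k] /= ltk].
  by case: m fm ltk => // m fm _; rewrite add0n modn_small.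
by rewrite modnDr modn_small // ltnW.
Qed.

(** On e_k this says that the weight of e_k is [tw] of that of e_(k-1); at k = 0 this is tw^m s =
    s. *)
Lemma weight_rep_rel {C : fieldType} (m : nat) (s : seq C) i :
  iter m tw s = s ->
  (weight_rep m s).1 i *m (weight_rep m s).2 =
    (weight_rep m s).2 *m (weight_rep m s).1 i *m (weight_rep m s).1 i.+1.
Proof.
move=> ms; apply/row_matrixP => k.
rewrite -mulmxA row_ord_pred_mul mulmx_diag mul_diag_mx.
apply/rowP => j; rewrite !mxE permE (iter_ord_pred _ ms) nth_tw.
case: eqP => [->|_]; first by rewrite mulr1.
by rewrite mulr0.
Qed.

(** Lets the relation [a_n, b] = 1 be read as the general one with a_(n+1) = 1. *)
Lemma weight_rep_default {C : fieldType} (m : nat) (s : seq C) i :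
  (size s <= i)%N -> (weight_rep m s).1 i = 1%:M.
Proof.
move=> si; rewrite -diag_const_mx; congr diag_mx; apply/rowP => k.
by rewrite !mxE nth_default ?size_iter_tw.
Qed.

Lemma weight_rep_unit {C : fieldType} (m : nat) (s : seq C) i :
  nonzero s -> (weight_rep m s).1 i \in unitmx.
Proof.
move=> sN; rewrite unitmxE det_diag unitfE; apply/prodf_neq0 => k _.
by rewrite mxE; apply/nth_nonzero/nonzero_iter_tw.
Qed.

Lemma weight_rep_is_rep {C : fieldType} (m : nat) (s : seq C) :
  (0 < size s)%N -> nonzero s -> iter m tw s = s -> is_rep (size s) (weight_rep m s).
Proof.
move=> s0 sN ms; have uB : (weight_rep m s).2 \in unitmx by apply: unitmx_perm.
split=> //= [i _|i j _ _|i _|]; rewrite ?weight_rep_unit //; first exact: diag_mxC.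
  by apply/mxcommP; rewrite ?weight_rep_unit ?weight_rep_rel.
by apply/mxcommP; rewrite ?weight_rep_unit ?weight_rep_rel // prednK // (@weight_rep_default _ _ _ (size s)).
Qed.

Lemma stable_row {F : fieldType} (m q : nat) (U : 'M[F]_m) (K : 'M[F]_m)
  (u : 'M_(q, m)) : stablemx U K -> (u <= U)%MS -> (u *m K <= U)%MS.
Proof. by move=> UK uU; apply: submx_trans (submxMr _ uU) UK. Qed.

(** A vector of [U] with nonzero j-th coordinate projects to a nonzero multiple of e_j, so e_j lies
    in [U]; b then carries it through the whole basis. *)
Lemma weight_rep_irr {C : fieldType} (m : nat) (s : seq C) :
  (0 < size s)%N -> (0 < m)%N -> nonzero s -> exact_period m s ->
  is_irr (size s) (weight_rep m s).
Proof.
move=> s0 m0 sN [ms sI]; split=> // [|U UA UB]; first exact: weight_rep_is_rep.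
have [->|U0] := eqVneq U 0; [by left; rewrite mxrank0 | right].
have /matrix0Pn[i [j Uij]] := U0.
have rowV k l : (l < size s)%N -> row k 1%:M *m (weight_rep m s).1 l =
    nth 1 (iter k tw s) l *: row k (1%:M : 'M[C]_m).
  by move=> _; rewrite -row_mul mul1mx row_diag_mx mxE rowE mulmx1.
have [K [Kj Kk UK]] := weight_proj (fun l k => @rowV k l) (fun k => size_iter_tw k s) sI j.
have ej : (row j (1%:M : 'M[C]_m) <= U)%MS.
  have : (row i U *m K <= U)%MS by apply: stable_row (row_sub _ _); apply: UK.
  rewrite -[row i U]mulmx1 (mulmx_sum_row (row i U)) mulmx_suml (bigD1 j) //= big1 => [|k kj].
    by rewrite addr0 -scalemxAl Kj mxE eqmx_scale.
  by rewrite -scalemxAl Kk // scaler0.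
have e k : (row k (1%:M : 'M[C]_m) <= U)%MS.
  apply: (@ord_pred_closed _ (fun k => (row k (1%:M : 'M[C]_m) <= U)%MS) j) => // l el.
  have := stable_row UB el.
  rewrite -row_mul mul1mx -[(weight_rep m s).2]mulmx1.
  by rewrite row_ord_pred_mul.
apply/eqP; rewrite -[_ == m]/(row_full U) -sub1mx.
by apply/row_subP.
Qed.

(** * Weight vectors in an arbitrary irreducible representation *)

Definition weight {C : fieldType} (n m : nat) (A : nat -> 'M[C]_m) (s : seq C)
    (v : 'rV[C]_m) : Prop :=
  forall i, (i < n)%N -> v *m A i = nth 1 s i *: v.

(** [conjmx (row_base W) D] is the matrix of [D] restricted to [W]; [row_base W] carries its
    eigenvector back. *)
Lemma stable_eigenvector {C : numClosedFieldType} (m : nat) (W D : 'M[C]_m) :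
  W != 0 -> stablemx W D ->
  exists v : 'rV[C]_m, exists a, [/\ v != 0, (v <= W)%MS & v *m D = a *: v].
Proof.
move=> W0 WD; have [|a /eigenvalueP[u uD u0]] := eigenvalue_closed (conjmx (row_base W) D).
  by rewrite lt0n mxrank_eq0.
exists (u *m row_base W), a; split.
- apply: contraNneq u0 => uW; apply/eqP/(row_free_inj (row_base_free W)).
  by rewrite /= uW mul0mx.
- by rewrite (submx_trans (submxMl _ _)) ?eq_row_base.
have stab : (row_base W *m D <= row_base W)%MS by rewrite stablemx_row_base.
by rewrite -mulmxA -(mulmxKpV stab) mulmxA -/(conjmx _ _) uD scalemxAl.
Qed.

Lemma irr_has_weight {C : numClosedFieldType} (n m : nat) (r : repT C m) :
  is_irr n r -> exists s, exists v,
    [/\ size s = n, nonzero s, v != 0 & weight n r.1 s v].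
Proof.
move=> [[uA uB AA AB AB1] m0 _].
have [|v v0 /allP vA] := @common_eigenvector C m [seq r.1 i | i <- iota 0 n] m0.
  move=> _ _ /mapP[i + ->] /mapP[j + ->]; rewrite !mem_iota => /= ? ?.
  exact: AA.
(* The guard makes the predicate boolean and satisfiable for every [i], so eigenvalues can be chosen
   as a function; 0 is a dummy beyond [n]. *)
have /all_sig[f Hf'] i : {a | (i < n)%N ==> (v *m r.1 i == a *: v)}.
  apply: sigW; case: (ltnP i n) => [lti|]; last by exists 0.
  have /vA : r.1 i \in [seq r.1 i | i <- iota 0 n].
    by apply: map_f; rewrite mem_iota.
  by move=> /sub_rVP[a va]; exists a; rewrite va eqxx implybT.
have Hf i : (i < n)%N -> v *m r.1 i = f i *: v.
  by move=> lti; apply/eqP; have := Hf' i; rewrite lti.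
exists (mkseq f n), v; split=> //; first by rewrite size_mkseq.
- apply/allP => _ /mapP[i + ->]; rewrite mem_iota /= => lti.
  apply: contraNneq v0 => fi0.
  by rewrite -[v](mulmxK (uA i lti)) Hf // fi0 scale0r mul0mx.
- by move=> i lti; rewrite nth_mkseq // Hf.
Qed.

(** The relations give b^-1 a_i = a_i a_(i+1) b^-1, with a_(n+1) = 1. *)
Lemma weight_shift {C : fieldType} (n m : nat) (r : repT C m) s v :
  is_rep n r -> size s = n -> weight n r.1 s v ->
  weight n r.1 (tw s) (v *m invmx r.2).
Proof.
move=> [uA uB AA AB AB1] sn vA i lti; rewrite nth_tw.
suff E : invmx r.2 *m r.1 i = (if (i.+1 < n)%N then r.1 i *m r.1 i.+1 else r.1 i) *m invmx r.2.
  rewrite -mulmxA E mulmxA; case: ifP => ltSi.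
    by rewrite mulmxA vA // -!scalemxAl vA // -scalemxAl !scalerA.
  rewrite vA // [nth 1 s i.+1]nth_default ?mulr1 -?scalemxAl //.
  by rewrite sn leqNgt ltSi.
apply: (canRL (mulmxK uB)); rewrite -mulmxA; apply: (canLR (mulKmx uB)).
case: ifP => ltSi.
  have /mxcommP -> // := AB i ltSi; last exact: uA.
  by rewrite mulmxA.
have /eqP in1 : i.+1 == n by rewrite eqn_leq lti leqNgt ltSi.
have := AB1; rewrite -in1 /= => /mxcommP -> //; last exact: uA.
by rewrite mulmx1.
Qed.

Definition shift {C : fieldType} (m : nat) (B : 'M[C]_m) (k : nat) : 'rV[C]_m -> 'rV[C]_m :=
  iter k (mulmxr (invmx B)).

Lemma weight_iter {C : fieldType} (n m : nat) (r : repT C m) s v k :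
  is_rep n r -> size s = n -> weight n r.1 s v ->
  weight n r.1 (iter k tw s) (shift r.2 k v).
Proof.
move=> rr sn vA; elim: k => //= k IHk; apply: weight_shift => //.
by rewrite size_iter_tw.
Qed.

Lemma shift_neq0 {C : fieldType} (m : nat) (B : 'M[C]_m) k v :
  B \in unitmx -> v != 0 -> shift B k v != 0.
Proof.
move=> uB v0; elim: k => //= k; apply: contraNneq => vB.
by rewrite -[shift B k v](mulmxKV uB) vB mul0mx.
Qed.

Lemma shift_mul {C : fieldType} (m : nat) (B : 'M[C]_m) k :
  exists D : 'M[C]_m, forall v, shift B k v = v *m D.
Proof.
elim: k => [|k [D HD]]; first by exists 1%:M => v; rewrite mulmx1.
by exists (D *m invmx B) => v; rewrite mulmxA -HD.
Qed.

Lemma weights_free {C : fieldType} (n m : nat) (r : repT C m) s v d :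
  is_rep n r -> size s = n -> weight n r.1 s v -> v != 0 ->
  injective (fun k : 'I_d => iter k tw s) ->
  row_free (\matrix_(k < d) shift r.2 k v).
Proof.
move=> rr sn vs v0 sI; have [_ uB _ _ _] := rr.
apply: (@weight_free _ n d m r.1 _ (fun k : 'I_d => iter k tw s)) => //.
- by move=> i k lti; rewrite rowK (weight_iter k rr sn vs).
- by move=> k; rewrite size_iter_tw.
- by move=> k; rewrite rowK shift_neq0.
Qed.

Lemma tw_period {C : fieldType} (m : nat) (s : seq C) :
  nonzero s -> ~ injective (fun k : 'I_m.+1 => iter k tw s) ->
  exists2 d, (0 < d)%N & exact_period d s.
Proof.
move=> sN sI.
have /ex_minnP[d /andP[d0 /eqP ds] dmin] : exists d, (0 < d)%N && (iter d tw s == s).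
  have /injectivePn[i [j neij eqij]] : ~~ injectiveb (fun k : 'I_m.+1 => iter k tw s).
    by apply/negP => /injectiveP.
  have [ltij|ltji|/val_inj eij] := ltngtP i j; last by rewrite eij eqxx in neij.
    by exists (j - i)%N; rewrite subn_gt0 ltij iter_tw_sub ?eqxx.
  by exists (i - j)%N; rewrite subn_gt0 ltji iter_tw_sub ?eqxx.
exists d => //; apply: exact_period_min => // j /andP[j0 ltj].
by apply: contraL ltj => sj; rewrite -leqNgt dmin // j0.
Qed.

Lemma unitmx11 {C : fieldType} (X : 'M[C]_1) : (X \in unitmx) = (X 0 0 != 0).
Proof. by rewrite unitmxE det_mx11 unitfE. Qed.

Lemma mxcomm11 {C : fieldType} (X Y : 'M[C]_1) :
  X \in unitmx -> Y \in unitmx -> mxcomm X Y = 1%:M.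
Proof.
move=> uX uY; apply/mxcommP => //; rewrite mulmx1.
by rewrite [X]mx11_scalar scalar_mxC.
Qed.

Lemma is_rep11 {C : fieldType} (n : nat) (c e : C) :
  c != 0 -> e != 0 ->
  is_rep n ((fun i => (if i == 0%N then c else 1)%:M : 'M[C]_1), e%:M : 'M[C]_1).
Proof.
move=> c0 e0; have u i : (if i == 0%N then c else 1)%:M \in @unitmx C 1.
  by rewrite unitmx11 mxE; case: ifP; rewrite ?oner_neq0.
have ue : e%:M \in @unitmx C 1 by rewrite unitmx11 mxE.
split; first by move=> i _; apply: u.
- exact: ue.
- by move=> i j _ _; apply: scalar_mxC.
- by move=> i _; exact: mxcomm11 (u _) ue.
- exact: mxcomm11 (u _) ue.
Qed.

(** The shifts of a weight vector that is also an eigenvector of b^-d can be rescaled so that b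
    permutes them cyclically up to one scalar [a]; by irreducibility they span. *)
Lemma exact_period_basis {C : numClosedFieldType} (n m d : nat) (r : repT C m) s v :
  is_irr n r -> (0 < n)%N -> size s = n -> v != 0 -> weight n r.1 s v ->
  (0 < d)%N -> exact_period d s ->
  exists a, exists P : 'M[C]_(d, m), [/\ a != 0, row_free P, row_full P,
     forall i (k : 'I_d), (i < n)%N -> row k P *m r.1 i = nth 1 (iter k tw s) i *: row k P
   & forall k : 'I_d, row k P *m r.2 = a *: row (ord_pred k) P].
Proof.
move=> [rr m0 irr] n0 sn v0 vs d0 [ds sI]; have [_ uB _ _ _] := rr.
(* [D] acts as the d-th shift; it preserves the weight space [W] of [s] because tw^d s = s. *)
have [D HD] := shift_mul r.2 d.
pose W : 'M[C]_m := (\bigcap_(i < n) eigenspace (r.1 i) (nth 1 s i))%MS.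
have memW u : (u <= W)%MS <-> weight n r.1 s u.
  split=> [/sub_bigcapmxP uW i lti|us].
    by apply/eigenspaceP; apply: (uW (Ordinal lti)).
  by apply/sub_bigcapmxP => i _; apply/eigenspaceP/us.
have [u [b [u0 /memW us uD]]] : exists u : 'rV[C]_m, exists b,
    [/\ u != 0, (u <= W)%MS & u *m D = b *: u].
  apply: stable_eigenvector.
    by apply: contraNneq v0 => W0; have /memW := vs; rewrite W0 submx0.
  apply/row_subP => k; rewrite row_mul -HD; apply/memW.
  by rewrite -ds; apply: weight_iter => //; apply/memW/row_sub.
have b0 : b != 0.
  apply: contraNneq (shift_neq0 d uB u0) => b0.
  by rewrite HD uD b0 scale0r.
(* Here [b] is the eigenvalue of [D] on [u]; a d-th root of its inverse makes the rescaled shifts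
   close up, [f d = f 0], as the wrap-around of [ord_pred] requires. *)
pose e := d.-root (b^-1).
have eb : e ^+ d = b^-1 by rewrite rootCK.
have e0 : e != 0.
  by apply: contraNneq b0 => e0; move: eb; rewrite e0 expr0n eqn0Ngt d0 /= => /esym/eqP; rewrite invr_eq0.
pose f k := e ^+ k *: shift r.2 k u.
have fS k : f k.+1 *m r.2 = e *: f k.
  by rewrite /f /= -scalemxAl mulmxKV // scalerA exprS.
have fd : f d = f 0%N.
  by rewrite /f HD uD eb scalerA mulVf // scale1r /= expr0 scale1r.
pose P := \matrix_(k < d) f k.
have Pb (k : 'I_d) : row k P *m r.2 = e *: row (ord_pred k) P.
  rewrite !rowK -fS; case: k => [[|k] ltk] /=.
    by rewrite add0n modn_small ?ltn_predL // prednK // fd.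
  by rewrite modnDr modn_small // ltnW.
have PA i (k : 'I_d) : (i < n)%N -> row k P *m r.1 i = nth 1 (iter k tw s) i *: row k P.
  by move=> lti; rewrite rowK -scalemxAl (weight_iter k rr sn us) // !scalerA mulrC.
have P0 (k : 'I_d) : row k P != 0.
  by rewrite rowK scaler_eq0 expf_eq0 (negPf e0) andbF /= shift_neq0.
exists e, P; split=> //.
  apply: (@weight_free _ n d m r.1 _ (fun k : 'I_d => iter k tw s)) => // k.
  by rewrite size_iter_tw.
have [||r0|rm] := irr <<P>>%MS.
- move=> i lti; rewrite (eqmxMr _ (genmxE P)) genmxE; apply/row_subP => k.
  by rewrite row_mul PA // scalemx_sub ?row_sub.
- rewrite (eqmxMr _ (genmxE P)) genmxE; apply/row_subP => k.
  by rewrite row_mul Pb // scalemx_sub ?row_sub.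
- have := P0 (Ordinal d0); move/eqP: r0; rewrite mxrank_eq0 => /eqP r0.
  have : (row (Ordinal d0) P <= <<P>>)%MS by rewrite genmxE row_sub.
  by rewrite r0 submx0 => ->.
- by rewrite /row_full -[\rank P]genmxE rm.
Qed.

(** More than m distinct weights would give more than m independent vectors, so [s] has some exact
    period d; the cyclic basis then forces d = m. *)
Lemma irr_twist_equiv_weight_rep {C : numClosedFieldType} (n m : nat) (r : repT C m) s v :
  is_irr n r -> (0 < n)%N -> size s = n -> nonzero s -> v != 0 ->
  weight n r.1 s v ->
  exact_period m s /\ twist_equiv n r (weight_rep m (1 :: behead s)).
Proof.
move=> irr n0 sn sN v0 vs; have [rr m0 _] := irr.
have [|d d0 ds] := @tw_period _ m s sN.
  move=> /(weights_free rr sn vs v0); rewrite /row_free => /eqP rk.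
  by have := rank_leq_col (\matrix_(k < m.+1) shift r.2 k v); rewrite rk ltnn.
have [a [P [a0 fP uP PA PB]]] := exact_period_basis irr n0 sn v0 vs d0 ds.
have dm : d = m by move: fP uP; rewrite /row_free /row_full => /eqP -> /eqP.
subst d; split=> //; case: s sn sN vs ds PA => [|b y] /= sn sN vs ds PA; first by rewrite -sn in n0.
have b0 : b != 0 by case/andP: sN.
(* The character sends a_1 to the inverse of s_1, b to the inverse of the scalar [a], and the other
   a_i to 1. *)
exists ((fun i => (if i == 0%N then b^-1 else 1)%:M : 'M[C]_1), a^-1%:M : 'M[C]_1).
split; first by apply: is_rep11; rewrite invr_neq0.
exists P; first by rewrite -row_full_unit.
split=> [i lti|] /=; apply/row_matrixP => k.
  rewrite -scalemxAr linearZ /= row_mul PA // scalerA mul_diag_mx.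
  apply/rowP => j; rewrite !mxE !iter_tw_cons /= mulr1n mul1r.
  by case: i lti => [|i] lti /=; rewrite ?mul1r ?mulrA ?mulVf ?mul1r.
rewrite -scalemxAr linearZ /= row_mul PB scalerA mxE mulr1n mulVf // scale1r.
by rewrite row_ord_pred_mul.
Qed.

(** * Twist classes as orbits of [tw] *)

(** Characters kill commutators, so a twist rescales only a_1 and b. *)
Lemma rep11_tail {C : fieldType} (n : nat) (chi : repT C 1) i :
  is_rep n chi -> (i.+1 < n)%N -> chi.1 i.+1 = 1%:M.
Proof. by move=> [uA uB _ AB _] lti; rewrite -AB // mxcomm11 // uA // ltnW. Qed.

(** At a nonzero entry (0, l) of the intertwiner, the two sides equate the tails of tw^l (1 :: y)
    and 1 :: z. *)
Lemma weight_rep_twist {C : fieldType} (m : nat) (y z : seq C) :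
  (0 < m)%N -> size y = size z ->
  twist_equiv (size y).+1 (weight_rep m (1 :: y)) (weight_rep m (1 :: z)) ->
  exists l, iter l tw y = z.
Proof.
case: m => // m _ syz [chi [rchi [P uP [PA _]]]].
have /rV0Pn[l Pl] : row ord0 P != 0.
  apply: contraTneq uP => P0; rewrite unitmxE (expand_det_row _ ord0) big1 ?unitr0 // => j _.
  by have /rowP/(_ j) := P0; rewrite !mxE => ->; rewrite mul0r.
exists l; apply: (@eq_from_nth _ 1); first by rewrite size_iter_tw.
move=> i; rewrite size_iter_tw => lti.
have := PA i.+1 lti; rewrite /= (rep11_tail rchi) // mxE mulr1n scale1r.
move=> /matrixP/(_ ord0 l); rewrite mul_mx_diag mul_diag_mx !mxE /= iter_tw_cons /=.
by rewrite mulrC; apply: mulIf; rewrite mxE in Pl.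
Qed.

(** Boolean form of [exact_period] for 1 :: y, usable in filtering lists. *)
Definition exactly_periodic {F : fieldType} (m : nat) (y : seq F) : bool :=
  periodic m y && [forall j : 'I_m, (0 < j)%N ==> ~~ periodic j y].

Lemma exactly_periodicP {F : fieldType} (m : nat) (b : F) (y : seq F) :
  nonzero (b :: y) -> reflect (exact_period m (b :: y)) (exactly_periodic m y).
Proof.
move=> byN; have /andP[b0 yN] := byN.
apply: (iffP andP) => [[py /forallP yP]|[bym byI]].
  apply: exact_period_min => // [|j /andP[j0 ltj]]; first by apply/eqP; rewrite iter_tw_cons_eq.
  by have := yP (Ordinal ltj); rewrite /= j0 -(iter_tw_cons_eq _ _ b0).
split; first by rewrite -(iter_tw_cons_eq _ _ b0) bym.
apply/forallP => j; apply/implyP => j0; rewrite -(iter_tw_cons_eq _ _ b0).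
apply/eqP => yj; have m0 : (0 < m)%N by rewrite (leq_trans j0) // ltnW.
by have /(congr1 val) /= j00 := byI j (Ordinal m0) yj; rewrite j00 in j0.
Qed.

Lemma card_seq_sub_pred {T : choiceType} (L L' : seq T) (P : pred T) :
  uniq L' -> (forall x, (x \in L') = (x \in L) && P x) ->
  #|[set x : seq_sub L | P (val x)]| = size L'.
Proof.
move=> uL' memL'; rewrite cardE -(size_map val).
apply: perm_size; apply: uniq_perm => // [|x].
  by rewrite map_inj_uniq ?enum_uniq //; apply: val_inj.
rewrite memL'; apply/mapP/andP => [[y + ->]|[xL Px]].
  by rewrite mem_enum inE => yP; split=> //; apply: (valP y).
by exists (SeqSub xL); rewrite // mem_enum inE.
Qed.

(* [L j] lists the y fixed by tw^j among those indexing irreducible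
   representations of degree m: the hypothesis on the sum is Burnside count. *)
Lemma rcount_orbits {C : numClosedFieldType} (k m r : nat) (L : nat -> seq (seq C)) :
  (0 < m)%N -> (forall j, uniq (L j)) ->
  (forall j y, (y \in L j) =
     [&& size y == k.+1, nonzero y, exactly_periodic m y & iter j tw y == y]) ->
  (\sum_(j < m) size (L j) = m * r)%N ->
  rcount C k.+2 m r.
Proof.
(* [L 0] holds all the candidates, since tw^0 fixes everything. *)
move=> m0 uL memL sumL; pose T : finType := seq_sub (L 0%N).
have memT (x : T) : [/\ size (val x) = k.+1, nonzero (val x) & exactly_periodic m (val x)].
  by have := valP x; rewrite memL => /and4P[/eqP].
(* The default of [insubd] is never reached: [tw] preserves the listed set. *)
pose f (x : T) : T := insubd x (tw (val x)).
have valf x : val (f x) = tw (val x).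
  rewrite val_insubd memL; have [sx xN xP] := memT x.
  rewrite size_tw sx eqxx nonzero_tw //= eqxx andbT.
  suff -> : exactly_periodic m (tw (val x)) by [].
  move: xP; rewrite /exactly_periodic periodic_tw // => /andP[-> /forallP xP].
  by apply/forallP => j; rewrite periodic_tw.
have valfj x j : val (iter j f x) = iter j tw (val x).
  by elim: j => //= j <-; rewrite valf.
have fm x : iter m f x = x.
  by apply: val_inj; rewrite valfj; have [_ _ /andP[/periodic_iter_tw]] := memT x.
have fI : injective f.
  move=> x y fxy; rewrite -(fm x) -(fm y) -(prednK m0) !iterSr.
  by rewrite fxy.
pose R := [set x in [set: T] | froot f x == x].
have cardR : r = #|R|.
  apply/eqP; rewrite -(eqn_pmul2l m0) -sumL -(orbit_count m0 fm) => [|x]; last by rewrite !inE.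
  apply/eqP/eq_bigr => j _; rewrite -(@card_seq_sub_pred _ (L 0%N) _ (fun y => iter j tw y == y)) //.
    by apply: eq_card => x; rewrite !inE -valfj (inj_eq val_inj).
  by move=> y; rewrite !memL eqxx andbT -!andbA.
pose g (i : 'I_r) : T := enum_val (cast_ord cardR i).
have gN i : nonzero (1 :: val (g i)) by rewrite /= oner_neq0; have [_ ->] := memT (g i).
have gR i : froot f (g i) = g i.
  by have := enum_valP (cast_ord cardR i); rewrite !inE => /eqP.
exists (fun i => weight_rep m (1 :: val (g i))); split.
- move=> i; have [sg _ eg] := memT (g i).
  have -> : k.+2 = size (1 :: val (g i)) by rewrite /= sg.
  by apply: weight_rep_irr => //; apply/exactly_periodicP.
- move=> i j; have [si _ _] := memT (g i); have [sj _ _] := memT (g j).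
  have -> : k.+2 = (size (val (g i))).+1 by rewrite si.
  move=> /(weight_rep_twist m0); rewrite si sj => /(_ erefl)[l gij].
  apply/(@cast_ord_inj _ _ cardR)/enum_val_inj; rewrite -/(g i) -/(g j) -gR -[RHS]gR.
  apply/eqP; rewrite (root_connect (fconnect_sym fI)).
  suff -> : g j = iter l f (g i) by apply: fconnect_iter.
  by apply: val_inj; rewrite valfj.
(* Completeness: a weight of [q] has a tail [y] in [L 0]; shifting the weight vector [l] times moves
   [y] to the representative [z] of its orbit. *)
move=> q qirr; have [s [v [ss sN v0 vs]]] := irr_has_weight qirr.
have [s_exact _] := irr_twist_equiv_weight_rep qirr isT ss sN v0 vs.
have [qrep _ _] := qirr; have [_ uB _ _ _] := qrep.
case: s ss sN vs s_exact => // b y [sy] byN vs /(exactly_periodicP _ byN) ey.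
have /andP[_ yN] := byN.
have yL : y \in L 0%N by rewrite memL sy ey !eqxx !andbT; exact: yN.
pose x : T := SeqSub yL; pose z := froot f x.
have zR : z \in R by rewrite !inE /= (root_root (fconnect_sym fI)).
exists (cast_ord (esym cardR) (enum_rank_in zR z)).
have -> : g (cast_ord (esym cardR) (enum_rank_in zR z)) = z.
  by rewrite /g cast_ordKV enum_rankK_in.
pose l := findex f x z.
have -> : val z = behead (iter l tw (b :: y)).
  by rewrite iter_tw_cons /= -(valfj x) iter_findex // connect_root.
apply: (proj2 (irr_twist_equiv_weight_rep qirr _ _ _ (shift_neq0 l uB v0) _)) => //.
- by rewrite size_iter_tw /= sy.
- exact: nonzero_iter_tw.
- by apply: weight_iter => //=; rewrite sy.
Qed.

(** * Counting in prime power degree *)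

Definition gcd_sum (k m : nat) : nat := (\sum_(j < m) gcdn j m ^ k)%N.

(** If tw^j fixes 1 :: y with 0 < j < p^(N+1), so does tw^g for g = gcd(j, p^(N+1)), a proper
    divisor of p^(N+1) and hence a divisor of p^N. *)
Lemma exactly_periodic_prime_power {F : fieldType} (p N : nat) (y : seq F) : prime p ->
  exactly_periodic (p ^ N.+1) y = periodic (p ^ N.+1) y && ~~ periodic (p ^ N) y.
Proof.
move=> pp; rewrite /exactly_periodic; apply: andb_id2l => py.
have lt : (p ^ N < p ^ N.+1)%N by rewrite ltn_exp2l // prime_gt1.
apply/forallP/idP => [/(_ (Ordinal lt)) /=|pN j]; first by rewrite expn_gt0 prime_gt0.
apply/implyP => j0; apply: contra pN => yj.
have m0 : (0 < p ^ N.+1)%N by rewrite expn_gt0 prime_gt0.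
have yg : periodic (gcdn j (p ^ N.+1)) y.
  by rewrite /periodic -iter_gcdn_id //; apply/eqP.
have /(dvdn_pfactor _ _ pp)[l lN gl] := dvdn_gcdr j (p ^ N.+1).
apply: periodic_dvd yg; rewrite gl dvdn_exp2l // -ltnS ltn_neqAle lN andbT.
apply/eqP => lN1; have := dvdn_leq j0 (dvdn_gcdl j (p ^ N.+1)).
by rewrite gl lN1 leqNgt ltn_ord.
Qed.

(** Such a [y] is fixed by tw^m, so tw^j fixes it exactly when tw^gcd(j, m) does, and gcd(j, m)
    divides m. *)
Lemma fix_lists {C : numClosedFieldType} (k m : nat) : (0 < m)%N ->
  exists L : nat -> seq (seq C), [/\ forall j, uniq (L j),
    forall j, size (L j) = (m * gcdn j m ^ k)%N &
    forall j y, (y \in L j) =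
      [&& size y == k.+1, nonzero y, periodic m y & iter j tw y == y]].
Proof.
move=> m0; have f j := @periodic_fix_list C m (gcdn j m) k m0 (dvdn_gcdr j m).
exists (fun j => sval (f j)); split=> j; case: (f j) => L /= [] // uL sL memL y.
rewrite memL; case: eqP => //= _; case: (nonzero y) => //=; apply: andb_id2l => py.
by rewrite -iter_gcdn_id // periodic_iter_tw.
Qed.

Lemma rcount_one {C : numClosedFieldType} (k : nat) : rcount C k.+2 1 1.
Proof.
have [L [uL sL memL]] := @fix_lists C k 1 isT.
apply: (@rcount_orbits C k 1 1 L) => // [j y|].
  rewrite memL; congr [&& _, _, _ & _]; rewrite /exactly_periodic.
  suff -> : [forall j0 : 'I_1, (0 < j0)%N ==> ~~ periodic j0 y] by rewrite andbT.
  by apply/forallP => j0; rewrite ord1.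
by rewrite big_ord1 sL gcdn1 exp1n.
Qed.

Lemma rcount_prime_power {C : numClosedFieldType} (k p N : nat) : prime p ->
  rcount C k.+2 (p ^ N.+1) (gcd_sum k (p ^ N.+1) - gcd_sum k (p ^ N)).
Proof.
move=> pp; have m0 M : (0 < p ^ M)%N by rewrite expn_gt0 prime_gt0.
have [L [uL sL memL]] := @fix_lists C k _ (m0 N.+1).
have [L' [uL' sL' memL']] := @fix_lists C k _ (m0 N).
have subL j y : y \in L' j -> y \in L j.
  rewrite memL memL' => /and4P[-> -> py ->]; rewrite andbT /=.
  by apply: periodic_dvd py; rewrite dvdn_exp2l.
apply: (@rcount_orbits C k _ _ (fun j => filter (predC (mem (L' j))) (L j))) => //.
- by move=> j; rewrite filter_uniq.
- move=> j y; rewrite mem_filter /= memL memL' exactly_periodic_prime_power //.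
  by do !case: (_ == _); case: (nonzero y); case: (periodic _ _); case: (periodic _ _).
have sizeE j : (size (filter (predC (mem (L' j))) (L j)) + size (L' j) = size (L j))%N.
  rewrite -(count_predC (mem (L' j)) (L j)) addnC size_filter; congr (_ + _)%N.
  rewrite -size_filter; apply/perm_size/uniq_perm; rewrite ?filter_uniq // => y.
  by rewrite mem_filter /=; apply/idP/andP => [yL|[]//]; split=> //; apply: subL.
rewrite mulnBr; apply/(canRL (addnK _)).
(* The counts at level N depend on j only modulo p^N, so the range j < p^(N+1) repeats their sum p
   times. *)
have -> : (p ^ N.+1 * gcd_sum k (p ^ N) = \sum_(j < p ^ N.+1) size (L' j))%N.
  under eq_bigr => j _ do rewrite sL'.
  have := @sum_periodic p (p ^ N) (fun j => p ^ N * gcdn j (p ^ N) ^ k)%N.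
  rewrite -expnS => ->; last by move=> j; rewrite ![gcdn _ (p ^ N)]gcdnC gcdnDl.
  by rewrite -big_distrr /= mulnA -expnS.
rewrite -big_split /=; under eq_bigr => j _ do rewrite sizeE sL.
by rewrite -big_distrr.
Qed.

(** * The generating function *)

Lemma coef_mul_1subZX {R : comNzRingType} (Q : {poly R}) (a : R) i :
  (Q * (1 - a *: 'X))`_i = Q`_i - (if i is j.+1 then a * Q`_j else 0).
Proof.
rewrite mulrBr mulr1 -scalerAr coefB coefZ coefMX.
by case: i => [|i]; rewrite ?mulr0.
Qed.

Unset Implicit Arguments.

(* zeta^{irr}_{M_{p+1},p}(s) = sum_N r_{p^N} t^N with t = p^{-s}, as a formal
   power series in t, equals (1-t)^2 / ((1 - p^{p-1} t)(1 - p t)); equivalently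
   (sum_N r_{p^N} t^N) * (1 - p^{p-1} t)(1 - p t) = (1-t)^2, checked on all
   truncations. *)
Theorem theorem1 (C : numClosedFieldType) (p : nat) (hp : prime p) :
  exists r : nat -> nat,
    (forall N : nat, rcount C p.+1 (p ^ N) (r N)) /\
    (forall K i : nat, (i < K)%N ->
       ((\sum_(N < K) ((r N)%:R *: 'X^N : {poly int}))
          * ((1 - (p ^ (p - 1))%:R *: 'X) * (1 - p%:R *: 'X)))`_i
       = ((1 - 'X) ^+ 2 : {poly int})`_i).
Proof.
(* [S N] is the number of orbits of period dividing p^N; for n = p + 1 the exponent n - 2 is p -
   1. *)
pose S N := gcd_sum (p - 1) (p ^ N).
have S0 : S 0%N = 1%N by rewrite /S /gcd_sum expn0 big_ord1 gcdn1 exp1n.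
have SS N : (S N.+1 + p ^ N = p ^ (p - 1) * S N + p ^ N.+1)%N.
  exact: gcd_sum_prime_power.
have p1 : p.+1 = (p - 1).+2 by have := prime_gt0 hp; lia.
pose r N := if N is M.+1 then (S N - S M)%N else 1%N.
exists r; split=> [[|N]|K i ltiK].
- by rewrite p1; apply: rcount_one.
- by rewrite p1; apply: rcount_prime_power.
have q0 : (0 < p ^ (p - 1))%N by rewrite expn_gt0 prime_gt0.
(* Monotonicity makes the truncated differences in [r] true differences. *)
have leS N : (S N <= S N.+1)%N.
  have := SS N; have : (p ^ N <= p ^ N.+1)%N by rewrite leq_exp2l // prime_gt1.
  have : (S N <= p ^ (p - 1) * S N)%N by rewrite leq_pmull.
  by move: (S N) (S N.+1) (p ^ (p - 1) * S N)%N => *; lia.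
rewrite -(poly_def K (fun N => (r N)%:R)) mulrA !coef_mul_1subZX expr2.
have -> : (1 - 'X : {poly int}) * (1 - 'X) = 1 * (1 - 1 *: 'X) * (1 - 1 *: 'X).
  by rewrite scale1r mul1r.
rewrite !coef_mul_1subZX !coef_poly.
have rS N : (r N.+1)%:R = (S N.+1)%:R - (S N)%:R :> int by rewrite /r natrB.
have SSz N : (S N.+1)%:R = (p ^ (p - 1))%:R * (S N)%:R + p%:R * (p ^ N)%:R - (p ^ N)%:R :> int.
  by apply/(canRL (addrK _)); rewrite -natrD SS natrD !natrM expnS natrM.
have r0 : (r 0%N)%:R = 1 :> int by [].
(* Coefficient i involves [r] at i, i - 1 and i - 2; for i = 0 and i = 1 some terms are absent. *)
case: i ltiK => [|[|i]] ltiK; rewrite ?coef_mul_1subZX ?coef_poly ltiK ?(ltnW ltiK) !coef1 /=.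
- by rewrite r0; ring.
- by rewrite rS r0 SSz S0 expn0; ring.
rewrite (ltnW (ltnW ltiK)).
(* Coefficient 2 is apart because [r 0] is 1 and not a difference of values of [S]. *)
case: i ltiK => [|i] ltiK; rewrite !rS ?r0 !SSz ?S0 ?expn0 ?expnS ?natrM /=; ring.
Qed.
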